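(* Let $(M,L)$ and $(M,\widetilde L)$ be conformally related Finsler manifolds. Then $(M,L)$ is $C^{v}$-recurrent if and only if $(M,\widetilde{L})$ is $C^{v}$-recurrent; likewise, $(M,L)$ is $C^{0}$-recurrent if and only if $(M,\widetilde{L})$ is $C^{0}$-recurrent.
   Context: $M$ is a real paracompact $C^\infty$ manifold of finite dimension $n$; all objects are $C^\infty$. $\pi:\mathcal{T}M\to M$ is the bundle of nonzero tangent vectors, $\pi^{-1}(TM)$ the pullback of $TM$ by $\pi$. Sections of $\pi^{-1}(TM)$ are called $\pi$-vector fields; $\pi$-forms are forms on $\pi^{-1}(TM)$; $\overline\eta(u)=(u,u)$. $\rho:T(\mathcal{T}M)\to\pi^{-1}(TM)$ is $\rho=(\pi_{\mathcal{T}M},d\pi)$ and $\gamma:\pi^{-1}(TM)\to T(\mathcal{T}M)$ is the vertical lift. For a linear connection $D$ on $\pi^{-1}(TM)$, $K(X):=D_X\overline\eta$; $D$ is regular if $T(\mathcal{T}M)=V(\mathcal{T}M)\oplus H(\mathcal{T}M)$ with $H=\ker K$, $V$ the vertical bundle, and then $\beta:=(\rho|_{H})^{-1}$. Torsion: $\mathbf{T}(X,Y)=D_X\rho Y-D_Y\rho X-\rho[X,Y]$, $Q(\overline X,\overline Y)=\mathbf{T}(\beta\overline X,\beta\overline Y)$, $T(\overline X,\overline Y)=\mathbf{T}(\gamma\overline X,\beta\overline Y)$. Curvature: $\mathbf{K}(X,Y)\rho Z=-D_XD_Y\rho Z+D_YD_X\rho Z+D_{[X,Y]}\rho Z$, $\widehat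 P(\overline X,\overline Y)=\mathbf{K}(\beta\overline X,\gamma\overline Y)\overline\eta$. $(M,L)$ is a Finsler manifold with Finsler metric $g$ on $\pi^{-1}(TM)$. The Cartan connection $\nabla$ is the unique regular connection with $\nabla g=0$, $Q=0$ and $g(T(\overline X,\overline Y),\overline Z)=g(T(\overline X,\overline Z),\overline Y)$; $T$, $K$, $\beta$, $\widehat P$ are those of $\nabla$. The Berwald connection is $D^\circ_X\overline Y=\nabla_X\overline Y+\widehat P(\rho X,\overline Y)-T(KX,\overline Y)$. $(M,L)$ is $C^v$-recurrent if $\nabla_{\gamma\overline X}T=\lambda_o(\overline X)T$ for all $\overline X$, for some $\pi$-form $\lambda_o$ of order one. It is $C^0$-recurrent if $D^\circ_{\gamma\overline X}T=\lambda_o(\overline X)T$ for all $\overline X$, for some $\pi$-form $\lambda_o$ of order one. $(M,L)$ and $(M,\widetilde L)$ are conformally related if $\widetilde g=e^{2\sigma(x)}g$ for a positive differentiable function $\sigma$ on $M$. *)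

(* Defs.v *)
From HB Require Import structures.
From mathcomp Require Import all_boot all_order all_algebra.
From mathcomp Require Import all_classical all_reals all_analysis.
Set Implicit Arguments.
Unset Strict Implicit.
Unset Printing Implicit Defensive.
Import Order.TTheory GRing.Theory Num.Theory.
Import numFieldNormedType.Exports.
Local Open Scope classical_set_scope.
Local Open Scope ring_scope.

Section Smoothness.
Variables (R : realType) (V W : normedModType R).

(* C^k for finite-dimensional V, on an open set U. *)
Fixpoint Ck (k : nat) (U : set V) (f : V -> W) : Prop :=
  match k with
  | 0 => forall x, U x -> {for x, continuous f}
  | k'.+1 => (forall x, U x -> differentiable f x) /\
             (forall v : V, Ck k' U ('D_v f))
  end.

Definition smooth_on (U : set V) (f : V -> W) : Prop := forall k, Ck k U f.

End Smoothness.

(* An indexed family of charts on X with values in V, without axioms; the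
   values of coord i outside dom i are irrelevant. *)
Record atlas (X : Type) (V : Type) := Atlas {
  idx : Type;
  dom : idx -> set X;
  coord : idx -> X -> V }.
Arguments Atlas {X V}.

Section Charts.
Variables (R : realType) (V : normedModType R) (X : Type) (A : atlas X V).

Definition chart_image (i : idx A) : set V := coord i @` dom i.

(* F \o (coord i)^-1 on chart_image i, and 0 elsewhere. *)
Definition local_expr (W : normedModType R) (i : idx A) (F : X -> W) (x : V) : W :=
  if pselect (exists2 p, dom i p & coord i p = x) is left e
  then F (s2val (cid2 e)) else 0.

Definition smooth_in (W : normedModType R) (i : idx A) (F : X -> W) : Prop :=
  smooth_on (chart_image i) (local_expr i F).

Definition smooth (W : normedModType R) (F : X -> W) : Prop :=
  forall i, smooth_in i F.

(* A tangent vector at p is the family of its components in all the charts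
   around p; components in the other charts are set to 0, so that the tangent
   vectors at p form a subspace of the function space idx A -> V. *)
Definition vfam : Type := idx A -> V.

Definition tangent (p : X) (v : vfam) : Prop :=
  (forall i j, dom i p -> dom j p ->
     v j = 'd (local_expr i (coord j)) (coord i p) (v i)) /\
  (forall i, ~ dom i p -> v i = 0).

Definition bracket (Y Z : X -> vfam) : X -> vfam := fun p i =>
  if pselect (dom i p) then
    'D_(Y p i) (local_expr i (fun q => Z q i)) (coord i p)
    - 'D_(Z p i) (local_expr i (fun q => Y q i)) (coord i p)
  else 0.

End Charts.

Definition paracompact (T : topologicalType) : Prop :=
  forall C : set (set T),
    (forall U, C U -> open U) -> \bigcup_(U in C) U = setT ->
  exists D : set (set T),
    [/\ forall U, D U -> open U,
        \bigcup_(U in D) U = setT,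
        forall U, D U -> exists2 U', C U' & U `<=` U'
      & forall x : T, exists2 N, nbhs x N &
          finite_set [set U | D U /\ U `&` N !=set0]].

Record smooth_manifold (R : realType) (n : nat) (M : topologicalType)
    (A : atlas M 'rV[R]_n) : Prop := SmoothManifold {
  charts_cover : forall p, exists i : idx A, dom i p;
  chart_dom_open : forall i : idx A, open (dom i);
  chart_inj : forall i : idx A, set_inj (dom i) (coord i);
  chart_continuous : forall (i : idx A) p, dom i p -> {for p, continuous (coord i)};
  chart_open_map : forall (i : idx A) (O : set M),
    O `<=` dom i -> open O -> open (coord i @` O);
  transition_smooth : forall i j : idx A,
    smooth_on (coord i @` (dom i `&` dom j)) (local_expr i (coord j));
  manifold_hausdorff : hausdorff_space M;
  manifold_paracompact : paracompact M }.

Section SlitTangentBundle.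
Variables (R : realType) (n : nat) (M : topologicalType) (A : atlas M 'rV[R]_n).

Definition slit : Type :=
  {u : M * vfam A | tangent u.1 u.2 /\ u.2 <> (fun=> 0)}.

Definition base (u : slit) : M := (sval u).1.
Definition vec (u : slit) : vfam A := (sval u).2.

Definition slit_atlas : atlas slit ('rV[R]_n * 'rV[R]_n)%type :=
  Atlas (idx A) (fun i => [set u | dom i (base u)])
        (fun i u => (coord i (base u), vec u i)).

(* Families over slit carrying sections of pi^{-1}(TM) and of T(slit);
   tangency and smoothness are separate predicates. *)
Definition pifield : Type := slit -> vfam A.
Definition tfield : Type := slit -> vfam slit_atlas.

Definition pi_vector_field (X : pifield) : Prop :=
  (forall u, tangent (base u) (X u)) /\
  (forall i : idx slit_atlas, smooth_in i (fun u => X u i)).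

Definition eta : pifield := vec.

Definition rho (w : vfam slit_atlas) : vfam A := fun i => (w i).1.
Definition gamma (v : vfam A) : vfam slit_atlas := fun i => (0, v i).

(* A linear connection on pi^{-1}(TM) : D u w Y is the covariant derivative
   of the pi-vector field Y along the tangent vector w at u. *)
Definition connection : Type := forall u : slit, vfam slit_atlas -> pifield -> vfam A.

Definition cov (D : connection) (X : tfield) (Y : pifield) : pifield :=
  fun u => D u (X u) Y.

(* The last clause says that D Y is a smooth 1-form with values in
   pi^{-1}(TM); it is tested on vector fields over chart domains. *)
Record linear_connection (D : connection) : Prop := LinearConnection {
  connection_tangent : forall u w Y,
    tangent u w -> pi_vector_field Y -> tangent (base u) (D u w Y);
  connection_linear : forall u a w1 w2 Y,
    tangent u w1 -> tangent u w2 -> pi_vector_field Y ->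
    D u (a *: w1 + w2) Y = a *: D u w1 Y + D u w2 Y;
  connection_additive : forall u w Y Z,
    tangent u w -> pi_vector_field Y -> pi_vector_field Z ->
    D u w (Y + Z) = D u w Y + D u w Z;
  connection_leibniz : forall u w (f : slit -> R^o) Y (i : idx slit_atlas),
    tangent u w -> smooth slit_atlas f -> pi_vector_field Y -> dom i u ->
    D u w (fun u' => f u' *: Y u') =
      'D_(w i) (local_expr i f) (coord i u) *: Y u + f u *: D u w Y;
  connection_smooth : forall (i : idx slit_atlas) (X : tfield) Y,
    (forall u, dom i u -> tangent u (X u)) ->
    smooth_in i (fun u => X u i) -> pi_vector_field Y ->
    smooth_in i (fun u => cov D X Y u i) }.

Section RegularConnection.
Variable D : connection.

Definition K (X : tfield) : pifield := cov D X eta.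

Definition vertical (u : slit) (w : vfam slit_atlas) : Prop :=
  tangent u w /\ rho w = 0.

Definition horizontal (u : slit) (w : vfam slit_atlas) : Prop :=
  tangent u w /\ D u w eta = 0.

Definition regular : Prop := forall u,
  (forall w, tangent u w ->
     exists w1 w2, [/\ vertical u w1, horizontal u w2 & w = w1 + w2]) /\
  (forall w, vertical u w -> horizontal u w -> w = 0).

(* (rho restricted to the horizontal space at u)^-1 *)
Definition beta (u : slit) (v : vfam A) : vfam slit_atlas :=
  xget 0 [set w | horizontal u w /\ rho w = v].

Definition rhoF (X : tfield) : pifield := fun u => rho (X u).
Definition gammaF (X : pifield) : tfield := fun u => gamma (X u).
Definition betaF (X : pifield) : tfield := fun u => beta u (X u).

Definition torsion (X Y : tfield) : pifield :=
  cov D X (rhoF Y) - cov D Y (rhoF X) - rhoF (bracket X Y).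

Definition torsionQ (X Y : pifield) : pifield := torsion (betaF X) (betaF Y).
Definition torsionT (X Y : pifield) : pifield := torsion (gammaF X) (betaF Y).

(* curvature X Y (rho Z) is the curvature bold-K(X, Y) rho Z. *)
Definition curvature (X Y : tfield) (Z : pifield) : pifield :=
  - cov D X (cov D Y Z) + cov D Y (cov D X Z) + cov D (bracket X Y) Z.

Definition Phat (X Y : pifield) : pifield := curvature (betaF X) (gammaF Y) eta.

Definition berwald (X : tfield) (Y : pifield) : pifield :=
  cov D X Y + Phat (rhoF X) Y - torsionT (K X) Y.

End RegularConnection.

Definition scalar_product (S : vfam A -> Prop) (b : vfam A -> vfam A -> R) : Prop :=
  [/\ forall a v1 v2 w, S v1 -> S v2 -> S w ->
        b (a *: v1 + v2) w = a * b v1 w + b v2 w,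
      forall v w, S v -> S w -> b v w = b w v
    & forall v, S v -> v <> 0 -> 0 < b v v].

(* L is the function (p, v) |-> L p v on TM; its values at pairs (p, v) with
   v not tangent at p are never used. *)
Definition metric (L : M -> vfam A -> R) (u : slit) (v w : vfam A) : R :=
  2^-1 * derive1 (fun s : R => derive1 (fun t : R =>
    L (base u) (vec u + s *: v + t *: w) ^+ 2 : R^o) 0 : R^o) 0.

Record finsler (L : M -> vfam A -> R) : Prop := Finsler {
  finsler_ge0 : forall p v, tangent p v -> 0 <= L p v;
  finsler_homogeneous : forall p v (t : R),
    tangent p v -> 0 < t -> L p (t *: v) = t * L p v;
  finsler_smooth : smooth slit_atlas (fun u => L (base u) (vec u) : R^o);
  finsler_metric : forall u, scalar_product (tangent (base u)) (metric L u) }.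

Definition metrical (L : M -> vfam A -> R) (D : connection) : Prop :=
  forall u w Y Z (i : idx slit_atlas),
    tangent u w -> pi_vector_field Y -> pi_vector_field Z -> dom i u ->
    'D_(w i) (local_expr i (fun u' => metric L u' (Y u') (Z u') : R^o)) (coord i u) =
      metric L u (D u w Y) (Z u) + metric L u (Y u) (D u w Z).

Record cartan (L : M -> vfam A -> R) (D : connection) : Prop := Cartan {
  cartan_connection : linear_connection D;
  cartan_regular : regular D;
  cartan_metrical : metrical L D;
  cartan_Q : forall X Y, pi_vector_field X -> pi_vector_field Y ->
    torsionQ D X Y = 0;
  cartan_T : forall X Y Z,
    pi_vector_field X -> pi_vector_field Y -> pi_vector_field Z ->
    forall u, metric L u (torsionT D X Y u) (Z u) =
              metric L u (torsionT D X Z u) (Y u) }.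

Definition pi_form (lam : slit -> vfam A -> R) : Prop :=
  (forall u a v w, tangent (base u) v -> tangent (base u) w ->
     lam u (a *: v + w) = a * lam u v + lam u w) /\
  (forall X, pi_vector_field X -> smooth slit_atlas (fun u => lam u (X u) : R^o)).

(* Extension of a derivation delta of pi-vector fields to a (1,2) pi-tensor. *)
Definition derive_tensor (delta : pifield -> pifield)
    (T : pifield -> pifield -> pifield) (Y Z : pifield) : pifield :=
  delta (T Y Z) - T (delta Y) Z - T Y (delta Z).

(* nabla is the Cartan connection of the Finsler manifold. *)
Definition Cv_recurrent (nabla : connection) : Prop :=
  exists2 lam, pi_form lam & forall X Y Z,
    pi_vector_field X -> pi_vector_field Y -> pi_vector_field Z ->
    derive_tensor (cov nabla (gammaF X)) (torsionT nabla) Y Z =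
      (fun u => lam u (X u) *: torsionT nabla Y Z u).

Definition C0_recurrent (nabla : connection) : Prop :=
  exists2 lam, pi_form lam & forall X Y Z,
    pi_vector_field X -> pi_vector_field Y -> pi_vector_field Z ->
    derive_tensor (berwald nabla (gammaF X)) (torsionT nabla) Y Z =
      (fun u => lam u (X u) *: torsionT nabla Y Z u).

Definition conformal (L Lt : M -> vfam A -> R) : Prop :=
  exists sigma : M -> R^o, [/\ smooth A sigma, forall x, 0 < sigma x
    & forall u v w, tangent (base u) v -> tangent (base u) w ->
        metric Lt u v w = expR (2 * sigma (base u)) * metric L u v w].

End SlitTangentBundle.

(* Main.v *)
(* In the coordinates of a chart, the rho-part of [gamma X, beta Y] is the
   derivative of Y along gamma X, since rho (gamma X) = 0 and rho (beta Y) = Y;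
   call it P(X, Y).  It involves no connection, and T(X, Y) =
   nabla_{gamma X} Y - P(X, Y).  As sigma is constant along the fibres, metricity
   of both Cartan connections gives
     g(nabla_{gamma X} Y, Z) + g(Y, nabla_{gamma X} Z)
       = g(nabla~_{gamma X} Y, Z) + g(Y, nabla~_{gamma X} Z),
   while the symmetry of g(T(X, Y), Z) in Y and Z makes
   g(nabla~_{gamma X} Y - nabla_{gamma X} Y, Z) symmetric in Y and Z, hence zero.
   So nabla and nabla~ agree along vertical vectors and have the same T.  The
   Berwald derivatives along gamma X agree too, because
   D0_{gamma X} Y = nabla_{gamma X} Y - T(nabla_{gamma X} eta, Y).  Both
   recurrence conditions therefore hold with the same form lambda_o. *)
Require Import Defs.
From HB Require Import structures.
From mathcomp Require Import all_boot all_order all_algebra.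
From mathcomp Require Import perm lra.
From mathcomp Require Import all_classical all_reals all_analysis.
(* [coord] must denote the chart coordinates, not the one of vector.v. *)
Import Defs.
Set Implicit Arguments.
Unset Strict Implicit.
Unset Printing Implicit Defensive.
Import Order.TTheory GRing.Theory Num.Theory.
Import numFieldNormedType.Exports.
Local Open Scope classical_set_scope.
Local Open Scope ring_scope.

(** * Calculus *)

Section Calculus.
Variables (R : realType) (V W : normedModType R).
Implicit Types (f g : V -> W) (U : set V).

(** The first-order expansion of [f] at [x] involves only values near [x], so it is one of [g] too,
    and [diff_unique] identifies the differential. Local expressions are controlled only on chart
    images, so most comparisons below are of this local kind. *)
Lemma is_diff_near_eq f g x :
  (\forall y \near x, f y = g y) -> differentiable f x -> is_diff x g ('d f x).
Proof.
move=> fg df; have fgx : f x = g x by exact: nbhs_singleton fg.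
have dfc : continuous ('d f x) by exact: diff_continuous.
have /diff_locallyP [_ /eqaddoP fE] := df.
have gE : g \o shift x = cst (g x) + 'd f x +o_ 0 id.
  apply/eqaddoP => _/posnumP[e].
  have fgs : \forall h \near 0, f (h + x) = g (h + x).
    by move: fg; rewrite (near_shift 0 x) subr0.
  have := fE e%:num [gt0 of e%:num].
  apply: filter_app; near=> h.
  rewrite !fctE /cst /= -fgx.
  by have -> : f (h + x) = g (h + x) by near: h.
have dgE : 'd g x = 'd f x :> (V -> W) by apply: diff_unique.
apply: DiffDef => //; apply/diff_locallyP; rewrite dgE.
by split.
Unshelve. all: by end_near. Qed.

Lemma differentiable_near_eq f g x :
  (\forall y \near x, f y = g y) -> differentiable f x -> differentiable g x.
Proof. by move=> fg df; have [] := is_diff_near_eq fg df. Qed.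

Lemma diff_near_eq f g x : (\forall y \near x, f y = g y) ->
  differentiable f x -> 'd g x = 'd f x :> (V -> W).
Proof. by move=> fg df; have [] := is_diff_near_eq fg df. Qed.

Lemma is_diff_linear (l : V -> W) x : linear l -> continuous l -> is_diff x l l.
Proof.
move=> ll lc; pose mll := GRing.isLinear.Build _ _ _ _ l ll.
pose L : {linear V -> W} := HB.pack l mll.
have -> : l = L by [].
apply: DiffDef; first exact: linear_differentiable.
exact: diff_lin.
Qed.

End Calculus.

Lemma is_diff_fst (R : realType) (V W : normedModType R) (z : V * W) :
  is_diff z (@fst V W) (@fst V W).
Proof. by apply: is_diff_linear => // y; exact: cvg_fst. Qed.

Lemma is_diff_snd (R : realType) (V W : normedModType R) (z : V * W) :
  is_diff z (@snd V W) (@snd V W).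
Proof. by apply: is_diff_linear => // y; exact: cvg_snd. Qed.

(** * Functions of class [Ck] on an open set *)

Section ContinuousDifferentiability.
Variables (R : realType) (V : normedModType R).
Variable U : set V.
Hypothesis Uo : open U.

(** Since [U] is open, a derivative at a point of [U] sees only values on [U]; the induction passes
    the agreement on to ['D_v f] and ['D_v g]. *)
Lemma Ck_ext (W : normedModType R) k (f g : V -> W) :
  (forall x, U x -> f x = g x) -> Ck k U f -> Ck k U g.
Proof.
elim: k f g => [|k IH] f g fg /=.
  move=> fc x Ux; have fgx : \forall y \near x, f y = g y.
    by apply: filterS (open_nbhs_nbhs (conj Uo Ux)) => y; exact: fg.
  have := fc x Ux; rewrite /continuous_at /prop_for fg // => fx.
  by apply: cvg_trans fx; exact: near_eq_cvg (filterS _ fgx).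
move=> [df Df].
have fgx x : U x -> \forall y \near x, f y = g y.
  by move=> Ux; apply: filterS (open_nbhs_nbhs (conj Uo Ux)) => y; exact: fg.
split=> [x Ux|v]; first exact: differentiable_near_eq (fgx x Ux) (df x Ux).
by apply: IH (Df v) => x Ux; apply: near_eq_derive; exact: fgx.
Qed.

Lemma CkW (W : normedModType R) k (f : V -> W) : Ck k.+1 U f -> Ck k U f.
Proof.
elim: k f => [|k IH] f [df Df].
  by move=> x Ux; apply: differentiable_continuous; exact: df.
by split=> // v; exact: IH.
Qed.

Lemma Ck_cst (W : normedModType R) k (c : W) : Ck k U (cst c).
Proof.
elim: k c => [|k IH] c; first by move=> x _; exact: cst_continuous.
split=> [x _|v]; first exact: differentiable_cst.
by apply: Ck_ext (IH 0) => x _; rewrite derive_cst.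
Qed.

Lemma Ck_comp_linear (W W' : normedModType R) k (l : W -> W') (f : V -> W) :
  linear l -> continuous l -> Ck k U f -> Ck k U (l \o f).
Proof.
move=> ll; pose mll := GRing.isLinear.Build _ _ _ _ l ll.
suff {mll ll} main (L : {linear W -> W'}) : continuous L -> Ck k U f -> Ck k U (L \o f).
  by move=> lc; exact: (main (HB.pack l mll : {linear W -> W'}) lc).
move=> {l} lc.
elim: k f => [|k IH] f /=.
  by move=> fc x Ux; apply: continuous_comp; [exact: fc|exact: lc].
move=> [df Df]; have dl y : differentiable L y by exact: linear_differentiable.
split=> [x Ux|v]; first by apply: differentiable_comp; [exact: df|].
apply: Ck_ext (IH _ (Df v)) => x Ux.
have dfx := df x Ux.
have dlf : differentiable (L \o f) x by exact: differentiable_comp.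
by rewrite /= (deriveE _ dlf) (deriveE _ dfx) (diff_comp dfx (dl _)) /= diff_lin.
Qed.

Lemma Ck_linear (W : normedModType R) k (l : V -> W) :
  linear l -> continuous l -> Ck k U l.
Proof.
move=> ll; pose mll := GRing.isLinear.Build _ _ _ _ l ll.
suff {mll ll} main (L : {linear V -> W}) : continuous L -> Ck k U L.
  by move=> lc; exact: (main (HB.pack l mll : {linear V -> W}) lc).
move=> {l} lc.
have dl y : differentiable L y by exact: linear_differentiable.
case: k => [|k]; first by move=> x _; exact: lc.
split=> [x _|v] //.
by apply: Ck_ext (Ck_cst k (L v)) => x _; rewrite deriveE // diff_lin.
Qed.

Lemma CkD (W : normedModType R) k (f g : V -> W) :
  Ck k U f -> Ck k U g -> Ck k U (f + g).
Proof.
elim: k f g => [|k IH] f g /=.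
  by move=> fc gc x Ux; apply: continuousD; [exact: fc|exact: gc].
move=> [df Df] [dg Dg].
split=> [x Ux|v]; first by apply: differentiableD; [exact: df|exact: dg].
apply: Ck_ext (IH _ _ (Df v) (Dg v)) => x Ux.
by rewrite deriveD //; apply: diff_derivable; [exact: df|exact: dg].
Qed.

Lemma Ck_sum (W : normedModType R) k (I : Type) (s : seq I) (F : I -> V -> W) :
  (forall i, Ck k U (F i)) -> Ck k U (fun x => \sum_(i <- s) F i x).
Proof.
move=> CF; elim: s => [|i s IH].
  by apply: Ck_ext (Ck_cst k 0) => x _; rewrite big_nil.
by apply: Ck_ext (CkD (CF i) IH) => x _; rewrite big_cons.
Qed.

Lemma CkM k (f g : V -> R^o) : Ck k U f -> Ck k U g -> Ck k U (fun x => f x * g x : R^o).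
Proof.
elim: k f g => [|k IH] f g.
  by move=> fc gc x Ux; apply: continuousM; [exact: fc|exact: gc].
move=> Cf Cg; have [df Df] := Cf; have [dg Dg] := Cg.
split=> [x Ux|v]; first by apply: differentiableM; [exact: df|exact: dg].
(* In the Leibniz rule each factor also occurs undifferentiated; [CkW] lowers it to the order of the
   induction hypothesis. *)
apply: Ck_ext (CkD (IH _ _ (CkW Cf) (Dg v)) (IH _ _ (CkW Cg) (Df v))) => x Ux.
by rewrite [RHS]deriveM //; apply: diff_derivable; [exact: df|exact: dg].
Qed.

Lemma Ck_row n k (f : V -> 'rV[R]_n) :
  (forall j, Ck k U (fun x => f x 0 j : R^o)) -> Ck k U f.
Proof.
move=> Cf.
have Cj j : Ck k U (fun x => f x 0 j *: delta_mx 0 j : 'rV[R]_n).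
  apply: (@Ck_comp_linear R^o 'rV[R]_n k (fun c => c *: delta_mx 0 j)) (Cf j).
    by move=> a u v; rewrite scalerDl scalerA.
  exact: scalel_continuous.
by apply: Ck_ext (Ck_sum (index_enum _) Cj) => x _; rewrite -row_sum_delta.
Qed.

Lemma Ck_coord n k (f : V -> 'rV[R]_n) j :
  Ck k U f -> Ck k U (fun x => f x 0 j : R^o).
Proof.
apply: (@Ck_comp_linear 'rV[R]_n R^o k (fun v => v 0 j)) => [a u v|].
  by rewrite !mxE.
exact: coord_continuous.
Qed.

Lemma CkZ n k (f : V -> R^o) (g : V -> 'rV[R]_n) :
  Ck k U f -> Ck k U g -> Ck k U (fun x => f x *: g x).
Proof.
move=> Cf Cg; apply: Ck_row => j.
by apply: Ck_ext (CkM Cf (Ck_coord j Cg)) => x _; rewrite mxE.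
Qed.

End ContinuousDifferentiability.

(** * Differentiability of row and matrix valued maps, determinants and inverses *)

Section RowValuedDifferentiability.
Variables (R : realType) (V : normedModType R) (x : V).

Lemma differentiable_bigsum (W : normedModType R) (I : Type) (s : seq I)
    (P : pred I) (F : I -> V -> W) :
  (forall i, differentiable (F i) x) ->
  differentiable (fun y => \sum_(i <- s | P i) F i y) x.
Proof.
move=> dF; elim: s => [|i s IH].
  have -> : (fun y => \sum_(i <- [::] | P i) F i y) = cst 0.
    by apply/funext => y; rewrite big_nil.
  exact: differentiable_cst.
have -> : (fun y => \sum_(j <- i :: s | P j) F j y) =
   if P i then F i + (fun y => \sum_(j <- s | P j) F j y)
   else fun y => \sum_(j <- s | P j) F j y.
  by case: ifPn => Pi; apply/funext => y; rewrite big_cons ?Pi // (negbTE Pi).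
by case: ifP => // _; apply: differentiableD.
Qed.

Lemma differentiable_prod (f g : V -> R) :
  differentiable (f : V -> R^o) x -> differentiable (g : V -> R^o) x ->
  differentiable (fun y => f y * g y : R^o) x.
Proof. exact: differentiableM. Qed.

Lemma differentiable_bigprod (I : Type) (s : seq I) (F : I -> V -> R) :
  (forall i, differentiable (F i : V -> R^o) x) ->
  differentiable (fun y => \prod_(i <- s) F i y : R^o) x.
Proof.
move=> dF; elim: s => [|i s IH].
  have -> : (fun y => \prod_(i <- [::]) F i y : R^o) = cst 1.
    by apply/funext => y; rewrite big_nil.
  exact: differentiable_cst.
have -> : (fun y => \prod_(j <- i :: s) F j y) =
   F i * (fun y => \prod_(j <- s) F j y).
  by apply/funext => y; rewrite big_cons.
exact: differentiableM.
Qed.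

Lemma differentiable_row n (f : V -> 'rV[R]_n) :
  (forall j, differentiable (fun y => f y 0 j : R^o) x) -> differentiable f x.
Proof.
move=> df; have -> : f = fun y => \sum_j f y 0 j *: delta_mx 0 j.
  by apply/funext => y; rewrite -row_sum_delta.
apply: differentiable_bigsum => j; exact: differentiableZl.
Qed.

Definition mx_differentiable m n (F : V -> 'M[R]_(m, n)) : Prop :=
  forall i j, differentiable (fun y => F y i j : R^o) x.

Lemma mx_differentiable_row n (f : V -> 'rV[R]_n) :
  differentiable f x -> mx_differentiable f.
Proof.
move=> df i j.
exact: (@differentiable_comp _ _ _ _ f (fun N : 'rV[R]_n => N i j) _ df
  (differentiable_coord (f x) i j)).
Qed.

Lemma mx_differentiable_mul m n p (F : V -> 'M[R]_(m, n)) (G : V -> 'M[R]_(n, p)) :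
  mx_differentiable F -> mx_differentiable G ->
  mx_differentiable (fun y => F y *m G y).
Proof.
move=> dF dG i j.
have -> : (fun y => (F y *m G y) i j) = fun y => \sum_k F y i k * G y k j.
  by apply/funext => y; rewrite mxE.
apply: (@differentiable_bigsum R^o) => k.
exact: differentiable_prod (dF i k) (dG k j).
Qed.

Lemma differentiable_det n (F : V -> 'M[R]_n) :
  mx_differentiable F -> differentiable (fun y => \det (F y) : R^o) x.
Proof.
move=> dF; apply: (@differentiable_bigsum R^o) => s.
apply: (@differentiable_prod (fun=> _) (fun y => \prod_i F y i (s i))).
  exact: differentiable_cst.
by apply: differentiable_bigprod => i; exact: dF.
Qed.

(** Cramer's rule writes the entries as cofactors over the determinant. It describes [invmx] on
    invertible matrices only, hence the condition near [x]. *)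
Lemma mx_differentiable_inv n (F : V -> 'M[R]_n) :
  (\forall y \near x, F y \in unitmx) ->
  mx_differentiable F -> mx_differentiable (fun y => invmx (F y)).
Proof.
move=> Fu dF i j.
apply: (@differentiable_near_eq _ _ _
  (fun y => (\det (F y))^-1 * cofactor (F y) j i : R^o)).
  by near=> y; rewrite /invmx ifT ?mxE //; near: y.
apply: (@differentiable_prod (fun y => (\det (F y))^-1) (fun y => cofactor (F y) j i)).
  apply: differentiableV; first exact: differentiable_det.
  by have := nbhs_singleton Fu; rewrite unitmxE unitfE.
apply: (@differentiable_prod (fun=> _) (fun y => \det _)).
  exact: differentiable_cst.
apply: differentiable_det => k l.
have -> : (fun y => (row' j (col' i (F y))) k l : R^o) = fun y => F y (lift j k) (lift i l).
  by apply/funext => y; rewrite !mxE.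
exact: dF.
Unshelve. all: by end_near. Qed.

Lemma differentiable_scale n (f : V -> R) (g : V -> 'rV[R]_n) :
  differentiable (f : V -> R^o) x -> differentiable g x ->
  differentiable (fun y => f y *: g y) x.
Proof.
move=> df dg; apply: differentiable_row => j.
have -> : (fun y => (f y *: g y) 0 j : R^o) = f * (fun y => g y 0 j).
  by apply/funext => y; rewrite mxE.
apply: differentiableM => //; exact: mx_differentiable_row.
Qed.

End RowValuedDifferentiability.


(** * Tangent vectors of an atlas *)

Section LocalExpressions.
Variables (R : realType) (V : normedModType R) (X : Type) (A : atlas X V).

Lemma local_exprE (W : normedModType R) (i : idx A) (F : X -> W) p :
  set_inj (dom i) (coord i) -> dom i p -> local_expr i F (coord i p) = F p.
Proof.
move=> inj dp; rewrite /local_expr; case: pselect => [e|[]]; last by exists p.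
case: (cid2 e) => q dq /= eq_qp; congr (F _).
by apply: inj; rewrite ?inE.
Qed.

Lemma local_expr_out (W : normedModType R) (i : idx A) (F : X -> W) x :
  ~ chart_image i x -> local_expr i F x = 0.
Proof.
by move=> nx; rewrite /local_expr; case: pselect => // -[p dp px]; case: nx; exists p.
Qed.

(** The condition [l 0 = 0] matches the default value 0 of local expressions off the chart image. *)
Lemma local_expr_comp (W W' : normedModType R) (l : W -> W') (i : idx A) (F : X -> W) :
  l 0 = 0 -> local_expr i (l \o F) = l \o local_expr i F.
Proof.
by move=> l0; apply/funext => x; rewrite /local_expr /=; case: pselect.
Qed.

Lemma local_expr_eq (W : normedModType R) (i : idx A) (F G : X -> W) :
  (forall p, dom i p -> F p = G p) -> local_expr i F = local_expr i G.
Proof.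
move=> FG; apply/funext => x; rewrite /local_expr; case: pselect => // e.
by case: (cid2 e) => p dp /= _; exact: FG.
Qed.

Lemma tangent0 p : tangent p (0 : vfam A).
Proof. by split=> // i j _ _; rewrite linear0. Qed.

Lemma tangentP p a (v w : vfam A) :
  tangent p v -> tangent p w -> tangent p (a *: v + w).
Proof.
move=> [v1 v2] [w1 w2]; split=> [i j di dj|i ndi].
  by rewrite !fctE linearP (v1 i j) // (w1 i j).
by rewrite !fctE v2 // w2 // scaler0 addr0.
Qed.

Lemma tangentD p (v w : vfam A) : tangent p v -> tangent p w -> tangent p (v + w).
Proof. by move=> tv tw; rewrite -[v]scale1r; exact: tangentP. Qed.

Lemma tangentZ p a (v : vfam A) : tangent p v -> tangent p (a *: v).
Proof. by move=> tv; rewrite -[_ *: _]addr0; apply: tangentP => //; exact: tangent0. Qed.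

Lemma tangentN p (v : vfam A) : tangent p v -> tangent p (- v).
Proof. by move=> tv; rewrite -scaleN1r; exact: tangentZ. Qed.

Lemma tangentB p (v w : vfam A) : tangent p v -> tangent p w -> tangent p (v - w).
Proof. by move=> tv tw; rewrite -[w]scale1r -scaleNr addrC; exact: tangentP. Qed.

(** The component in one chart around [p] fixes those in the other charts around [p] through the
    transitions, and the remaining components are 0. Equalities of tangent vectors are thus checked
    in a single chart. *)
Lemma tangent_inj i p (v w : vfam A) : dom i p ->
  tangent p v -> tangent p w -> v i = w i -> v = w.
Proof.
move=> di [v1 v2] [w1 w2] vw; apply/funext => j.
have [dj|ndj] := pselect (dom j p); last by rewrite v2 ?w2.
by rewrite (v1 i j) // (w1 i j) // vw.
Qed.

(** The common ground of the atlas of [M] and of the slit atlas, so that the facts on tangent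
    vectors serve both. *)
Record differentiable_atlas : Prop := DifferentiableAtlas {
  atlas_inj : forall i : idx A, set_inj (dom i) (coord i);
  atlas_open : forall i j : idx A, open (coord i @` (dom i `&` dom j));
  atlas_diff : forall (i j : idx A) p, dom i p -> dom j p ->
    differentiable (local_expr i (coord j)) (coord i p) }.

(** For a chart [i] around [p], this is the tangent vector at [p] with component [v] in that
    chart. *)
Definition tangent_ext (i : idx A) (p : X) (v : V) : vfam A := fun j =>
  if pselect (dom j p) then 'd (local_expr i (coord j)) (coord i p) v else 0.

Hypothesis HA : differentiable_atlas.

Lemma local_exprK (W : normedModType R) (i : idx A) (F : X -> W) p :
  dom i p -> local_expr i F (coord i p) = F p.
Proof. by apply: local_exprE; exact: atlas_inj. Qed.

Lemma near_chart (i j : idx A) p (P : V -> Prop) : dom i p -> dom j p ->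
  (forall q, dom i q -> dom j q -> P (coord i q)) ->
  \forall x \near coord i p, P x.
Proof.
move=> di dj Pq.
have /open_nbhs_nbhs : open_nbhs (coord i p) (coord i @` (dom i `&` dom j)).
  by split; [exact: atlas_open | exists p].
by apply: filterS => _ [q [qi qj] <-]; exact: Pq.
Qed.

Lemma open_chart_image (i : idx A) : open (chart_image i).
Proof. by have := atlas_open HA i i; rewrite setIid. Qed.

Lemma diff_transition_id (i : idx A) p : dom i p ->
  'd (local_expr i (coord i)) (coord i p) = id :> (V -> V).
Proof.
have [did <-] := is_diff_id (coord i p) => di; apply: diff_near_eq => //.
by apply: (near_chart di di) => q qi _; rewrite local_exprK.
Qed.

(** The chain rule applied to the cocycle identity of the transitions, which holds near [coord i p]
    on the overlap of [i] and [j]. *)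
Lemma diff_transition_comp (i j k : idx A) p : dom i p -> dom j p -> dom k p ->
  forall v, 'd (local_expr i (coord k)) (coord i p) v =
  'd (local_expr j (coord k)) (coord j p) ('d (local_expr i (coord j)) (coord i p) v).
Proof.
move=> di dj dk v.
have dij := atlas_diff HA di dj.
have djk := atlas_diff HA dj dk.
have e : local_expr i (coord j) (coord i p) = coord j p by rewrite local_exprK.
have djk' : differentiable (local_expr j (coord k)) (local_expr i (coord j) (coord i p)).
  by rewrite e.
rewrite (@diff_near_eq _ _ _ (local_expr j (coord k) \o local_expr i (coord j))).
- by rewrite (diff_comp dij djk') /= e.
- apply: (near_chart di dj) => q qi qj.
  by rewrite /= !local_exprK.
- exact: differentiable_comp.
Qed.

Lemma tangent_ext_tangent i p v : dom i p -> tangent p (tangent_ext i p v).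
Proof.
move=> di; split=> [j k dj dk|j ndj]; rewrite /tangent_ext; last by case: pselect.
by case: pselect => // ?; case: pselect => // ?; exact: diff_transition_comp.
Qed.

Lemma tangent_ext_coord i p v : dom i p -> tangent_ext i p v i = v.
Proof.
by move=> di; rewrite /tangent_ext; case: pselect => // ?; rewrite diff_transition_id.
Qed.

Lemma tangent_extE i p w : dom i p -> tangent p w -> w = tangent_ext i p (w i).
Proof.
move=> di tw; apply: (tangent_inj di tw (tangent_ext_tangent _ di)).
by rewrite tangent_ext_coord.
Qed.

Lemma tangent_ext_linear i p : linear (tangent_ext i p).
Proof.
move=> a v w; apply/funext => j; rewrite !fctE /tangent_ext; case: pselect => ?.
  by rewrite linearP.
by rewrite scaler0 addr0.
Qed.

End LocalExpressions.

(** * The slit tangent bundle *)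

Section SlitAtlas.
Variables (R : realType) (n : nat) (M : topologicalType) (A : atlas M 'rV[R]_n).
Hypothesis hM : smooth_manifold A.
Local Notation V := 'rV[R]_n.
Local Notation SA := (slit_atlas A).

Lemma manifold_atlas : differentiable_atlas A.
Proof.
split=> [i|i j|i j p di dj]; first exact: chart_inj hM i.
  apply: (chart_open_map hM) => [p []//|].
  by apply: openI; exact: chart_dom_open.
have [/(_ (coord i p)) + _] := transition_smooth hM i j 1.
by apply; exists p.
Qed.
Let HA := manifold_atlas.

Lemma slit_eq (u v : slit A) : base u = base v -> vec u = vec v -> u = v.
Proof.
case: u v => [[p v] ?] [[q w] ?]; rewrite /base /vec /= => e1 e2.
by apply: eq_exist => //=; rewrite e1 e2.
Qed.

Lemma vec_tangent (u : slit A) : tangent (base u) (vec u).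
Proof. by case: u => [[p v] []]. Qed.

Lemma vec_neq0 (u : slit A) (i : idx A) : dom i (base u) -> vec u i <> 0.
Proof.
move=> di v0; case: (svalP u) => _; apply.
apply: (tangent_inj di (vec_tangent u)); last exact: v0.
exact: tangent0.
Qed.

Lemma slit_lift (i : idx A) p y : dom i p -> y <> 0 ->
  exists2 u : slit A, base u = p & vec u i = y.
Proof.
move=> di y0; have t := tangent_ext_tangent HA y di.
have e := tangent_ext_coord HA y di.
have h : tangent p (tangent_ext i p y) /\ tangent_ext i p y <> (fun=> 0).
  by split=> // e0; apply: y0; rewrite -e e0.
by exists (exist _ (p, tangent_ext i p y) h).
Qed.

(** Over an overlap of base charts the fibre coordinate takes every nonzero value, so openness
    reduces to that of the base overlap and of the complement of 0. *)
Lemma slit_overlapE (i j : idx A) :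
  (@coord _ _ SA i) @` ((@dom _ _ SA i) `&` (@dom _ _ SA j)) =
  (fst @^-1` (coord i @` (dom i `&` dom j))) `&` (snd @^-1` [set~ 0]).
Proof.
apply/seteqP; split=> [_ [u [ui uj] <-]|[x y] [/= [p [di dj] <-] y0]].
  by split=> /=; [exists (base u) | exact: vec_neq0].
by have [u eu ev] := slit_lift di y0; exists u; rewrite /= eu // ev.
Qed.

(** The tangent map of the base transition. The differential is expanded in the standard basis
    because [Ck] speaks of derivatives in fixed directions. *)
Definition slit_transition (i j : idx A) (z : V * V) : V * V :=
  (local_expr i (coord j) z.1,
   \sum_k z.2 0 k *: 'D_(delta_mx 0 k) (local_expr i (coord j)) z.1).

Lemma diff_sum_derive (i j : idx A) p (y : V) : dom i p -> dom j p ->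
  \sum_k y 0 k *: 'D_(delta_mx 0 k) (local_expr i (coord j)) (coord i p) =
  'd (local_expr i (coord j)) (coord i p) y.
Proof.
move=> di dj; have df := atlas_diff HA di dj.
rewrite [in RHS](row_sum_delta y) linear_sum; apply: eq_bigr => k _.
by rewrite linearZ deriveE.
Qed.

Lemma slit_inj (i : idx A) : set_inj (@dom _ _ SA i) (@coord _ _ SA i).
Proof.
move=> u v; rewrite !inE => ui vi [e1 e2].
have e := chart_inj hM (mem_set ui) (mem_set vi) e1.
apply: slit_eq => //; apply: (tangent_inj (i := i) (p := base u)) => //.
  exact: vec_tangent.
by rewrite e; exact: vec_tangent.
Qed.

Lemma slit_transition_eq (i j : idx A) u : dom i (base u) -> dom j (base u) ->
  slit_transition i j (@coord _ _ SA i u) =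
  local_expr (A := SA) i (@coord _ _ SA j) (@coord _ _ SA i u).
Proof.
move=> ui uj; rewrite local_exprE //; last exact: slit_inj.
rewrite /slit_transition /= diff_sum_derive // local_exprK //.
by have [tg _] := vec_tangent u; rewrite (tg i j).
Qed.

Lemma open_slit_overlap (i j : idx A) :
  open ((@coord _ _ SA i) @` ((@dom _ _ SA i) `&` (@dom _ _ SA j))).
Proof.
rewrite slit_overlapE; apply: openI; apply: open_comp.
- by move=> z _; exact: cvg_fst.
- exact: atlas_open.
- by move=> z _; exact: cvg_snd.
- apply: closed_openC; apply: accessible_closed_set1.
  exact/hausdorff_accessible/norm_hausdorff.
Qed.

Lemma differentiable_slit_transition (i j : idx A) z :
  (coord i @` (dom i `&` dom j)) z.1 -> differentiable (slit_transition i j) z.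
Proof.
(* Order 2, since the second component contains first derivatives of the base transition. *)
move=> zD; have [df1 Df2] := transition_smooth hM i j 2.
have [dfst _] := is_diff_fst z; have [dsnd _] := is_diff_snd z.
apply: differentiable_pair.
  by apply: (differentiable_comp (g := local_expr i (coord j)) dfst); exact: df1.
apply: differentiable_bigsum => k; apply: differentiable_scale.
  exact: (mx_differentiable_row dsnd).
apply: (differentiable_comp (g := 'D_(delta_mx 0 k) (local_expr i (coord j))) dfst).
by have [+ _] := Df2 (delta_mx 0 k); apply.
Qed.

Lemma slit_atlas_differentiable : differentiable_atlas SA.
Proof.
split=> [i|i j|i j u ui uj]; [exact: slit_inj|exact: open_slit_overlap|].
apply: (differentiable_near_eq (f := slit_transition i j)).
  have /open_nbhs_nbhs : open_nbhs (@coord _ _ SA i u)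
      ((@coord _ _ SA i) @` ((@dom _ _ SA i) `&` (@dom _ _ SA j))).
    by split; [exact: open_slit_overlap | exists u].
  by apply: filterS => _ [v [vi vj] <-]; exact: slit_transition_eq.
by apply: differentiable_slit_transition; exists (base u).
Qed.
Let HS := slit_atlas_differentiable.

Lemma diff_slit_transition (i j : idx A) u : dom i (base u) -> dom j (base u) ->
  'd (local_expr (A := SA) i (@coord _ _ SA j)) (@coord _ _ SA i u) =
  'd (slit_transition i j) (@coord _ _ SA i u) :> (V * V -> V * V).
Proof.
move=> ui uj; apply: diff_near_eq.
  by apply: (near_chart HS (p := u) ui uj) => v vi vj; exact: slit_transition_eq.
by apply: differentiable_slit_transition; exists (base u).
Qed.

(** With the base point fixed, [slit_transition] is linear in the fibre coordinate, so its
    difference quotient along [(0, v i)] is constantly [(0, v j)]. *)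
Lemma gamma_tangent u (v : vfam A) : tangent (base u) v ->
  tangent (A := SA) u (gamma v).
Proof.
move=> tv; split=> [i j ui uj|i nui]; rewrite /gamma; last first.
  by have [_ ->] := tv.
rewrite diff_slit_transition // -deriveE; last first.
  by apply: differentiable_slit_transition; exists (base u).
apply/esym/lim_near_cst => //; near=> h.
have h0 : h != 0 by near: h; exact: nbhs_dnbhs_neq.
rewrite /slit_transition /= !scaler0 !add0r.
rewrite [X in _ *: X](_ : _ = (0, h *: v j)); last first.
  congr pair; rewrite ?subrr // -sumrB.
  have [tgv _] := tv; rewrite (tgv i j) // -diff_sum_derive // scaler_sumr.
  by apply: eq_bigr => k _; rewrite -scalerBl !mxE addrK scalerA.
by congr pair; rewrite /= ?scaler0 // scalerA mulVf // scale1r.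
Unshelve. all: by end_near. Qed.

(** The first component of [slit_transition] is the base transition composed with [fst]; the chain
    rule on both sides gives the transformation law. *)
Lemma rho_tangent u (w : vfam SA) : tangent (A := SA) u w -> tangent (base u) (rho w).
Proof.
move=> [tw w0]; split=> [i j ui uj|i nui]; rewrite /rho; last by rewrite w0.
rewrite (tw i j) // diff_slit_transition //.
have [dfst efst] := is_diff_fst (@coord _ _ SA i u).
have dt := atlas_diff HA ui uj.
have ds : differentiable (slit_transition i j) (@coord _ _ SA i u).
  by apply: differentiable_slit_transition; exists (base u).
have [df ef] := is_diff_fst (slit_transition i j (@coord _ _ SA i u)).
have e1 : 'd (fst \o slit_transition i j) (@coord _ _ SA i u) =
    fst \o 'd (slit_transition i j) (@coord _ _ SA i u) :> (V * V -> V).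
  by rewrite (diff_comp ds df) ef.
have e2 : 'd (local_expr i (coord j) \o fst) (@coord _ _ SA i u) =
    'd (local_expr i (coord j)) (coord i (base u)) \o fst :> (V * V -> V).
  by rewrite (diff_comp dfst dt) efst.
transitivity ('d (fst \o slit_transition i j) (@coord _ _ SA i u) (w i)).
  by rewrite e1.
by rewrite -[RHS]/(('d (local_expr i (coord j)) (coord i (base u)) \o fst) (w i)) -e2.
Qed.

End SlitAtlas.

(** * Pi-vector fields and their vertical derivatives *)

Section SmoothFunctions.
Variables (R : realType) (V : normedModType R) (X : Type) (A : atlas X V).
Hypothesis HA : differentiable_atlas A.

Lemma local_exprD (W : normedModType R) (i : idx A) (F G : X -> W) :
  local_expr i (F + G) = local_expr i F + local_expr i G.
Proof.
apply/funext => x.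
rewrite -[RHS]/(local_expr i F x + local_expr i G x) /local_expr.
by case: pselect => // ?; rewrite addr0.
Qed.

Lemma smooth_in_ext (W : normedModType R) (i : idx A) (F G : X -> W) :
  (forall p, dom i p -> F p = G p) -> smooth_in i F -> smooth_in i G.
Proof. by move=> FG; rewrite /smooth_in (local_expr_eq FG). Qed.

Lemma smooth_inD (W : normedModType R) (i : idx A) (F G : X -> W) :
  smooth_in i F -> smooth_in i G -> smooth_in i (F + G).
Proof.
move=> sF sG k; rewrite local_exprD.
exact: (CkD (open_chart_image HA i) (sF k) (sG k)).
Qed.

Lemma smooth_in_comp_linear (W W' : normedModType R) (l : W -> W') (i : idx A)
    (F : X -> W) :
  linear l -> continuous l -> smooth_in i F -> smooth_in i (l \o F).
Proof.
move=> ll lc sF k; rewrite local_expr_comp.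
  exact: (Ck_comp_linear (open_chart_image HA i) ll lc (sF k)).
by have := ll (-1) 0 0; rewrite scaler0 addr0 scaleN1r addNr.
Qed.

Lemma smooth_in_cst (W : normedModType R) (i : idx A) (c : W) :
  smooth_in i (fun=> c : W).
Proof.
move=> k; have iO := open_chart_image HA i; apply: (Ck_ext iO _ (Ck_cst iO k c)).
by move=> _ [p dp <-]; rewrite local_exprK.
Qed.

Lemma smooth_in_differentiable (W : normedModType R) (i : idx A) (F : X -> W) p :
  smooth_in i F -> dom i p -> differentiable (local_expr i F) (coord i p).
Proof. by move=> /(_ 1) [dF _] dp; apply: dF; exists p. Qed.

End SmoothFunctions.

Section PiVectorFields.
Variables (R : realType) (n : nat) (M : topologicalType) (A : atlas M 'rV[R]_n).
Hypothesis hM : smooth_manifold A.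
Local Notation V := 'rV[R]_n.
Local Notation SA := (slit_atlas A).
Local Notation scoord i := (@coord _ _ SA i).
Local Notation slocal i F := (local_expr (A := SA) i F).
Let HA := manifold_atlas hM.
Let HS := slit_atlas_differentiable hM.

Lemma pi_vector_field0 : pi_vector_field (0 : pifield A).
Proof.
split=> [u|i]; first exact: tangent0.
exact: (smooth_in_cst HS i (0 : V)).
Qed.

Lemma pi_vector_fieldD (X Y : pifield A) :
  pi_vector_field X -> pi_vector_field Y -> pi_vector_field (X + Y).
Proof.
move=> [tX sX] [tY sY]; split=> [u|i]; first exact: tangentD (tX u) (tY u).
exact: (smooth_inD HS (sX i) (sY i)).
Qed.

Lemma pi_vector_fieldB (X Y : pifield A) :
  pi_vector_field X -> pi_vector_field Y -> pi_vector_field (X - Y).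
Proof.
move=> pX [tY sY]; apply: pi_vector_fieldD => //; split=> [u|i].
  exact: (tangentN (tY u)).
apply: (smooth_in_comp_linear (l := -%R) HS _ _ (sY i)).
  by move=> a v w; rewrite opprD scalerN.
exact: opp_continuous.
Qed.

(** In a slit chart [eta] is the second projection. *)
Lemma eta_pi_vector_field : pi_vector_field (@eta R n M A).
Proof.
split=> [u|i k]; first exact: vec_tangent.
apply: (Ck_ext (open_chart_image HS i) (f := snd)).
  by move=> _ [u du <-]; rewrite (local_exprK HS).
apply: Ck_linear => //; first exact: (open_chart_image HS i).
by move=> z; exact: cvg_snd.
Qed.

Lemma gammaF_tangent (X : pifield A) u : pi_vector_field X ->
  tangent (A := SA) u (gammaF X u).
Proof. by move=> [tX _]; exact: gamma_tangent. Qed.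

Lemma gammaF_smooth (X : pifield A) (i : idx SA) : pi_vector_field X ->
  smooth_in i (fun u => gammaF X u i).
Proof.
move=> [_ sX].
apply: (smooth_in_comp_linear (l := fun v : V => (0 : V, v)) HS _ _ (sX i)).
  by move=> a v w; congr pair; rewrite /= ?scaler0 ?addr0.
move=> v; apply: differentiable_continuous.
by apply: differentiable_pair; [exact: differentiable_cst | exact: ex_diff].
Qed.

(* Independent of the chart because transitions are linear on the fibres. *)
Definition vertical_derive (X Y : pifield A) : pifield A := fun u i =>
  if pselect (dom i (base u)) then
    'D_((0, X u i) : V * V) (slocal i (fun v => Y v i)) (scoord i u)
  else 0.

Lemma vertical_deriveE (X Y : pifield A) u (i : idx A) : dom i (base u) ->
  vertical_derive X Y u i =
  'D_((0, X u i) : V * V) (slocal i (fun v => Y v i)) (scoord i u).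
Proof. by rewrite /vertical_derive; case: pselect. Qed.

Lemma slocal_fibre (Y : pifield A) (i j : idx A) u (v : vfam A) (h : R) :
  pi_vector_field Y -> tangent (base u) v -> dom i (base u) -> dom j (base u) ->
  slocal j (fun w => Y w j) (h *: ((0, v j) : V * V) + scoord j u) =
  'd (local_expr i (coord j)) (coord i (base u))
    (slocal i (fun w => Y w i) (h *: ((0, v i) : V * V) + scoord i u)).
Proof.
move=> [tY _] tv di dj.
have tw : tangent (base u) (h *: v + vec u) by apply: tangentP => //; exact: vec_tangent.
have lineE k : h *: ((0, v k) : V * V) + scoord k u =
    (coord k (base u), (h *: v + vec u) k).
  by congr pair; rewrite /= scaler0 add0r.
rewrite !lineE.
(* The line may meet the zero section, which is outside the slit bundle. There both local
   expressions take the default value 0, which the differential preserves. *)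
have [w0|w0] := pselect (h *: v + vec u = (fun=> 0)).
  have out k : dom k (base u) ->
      ~ chart_image (A := SA) k (coord k (base u), (h *: v + vec u) k).
    by move=> dk [z zk [_ e]]; apply: (vec_neq0 zk); rewrite e w0.
  by rewrite !local_expr_out ?linear0 //; exact: out.
pose u' : slit A := exist _ (base u, h *: v + vec u) (conj tw w0).
rewrite -[(coord j _, _)]/(scoord j u') -[(coord i _, _ i)]/(scoord i u').
rewrite !(local_exprK HS) //.
by have [tYu _] := tY u'; exact: tYu.
Qed.

(** By [slocal_fibre] the difference quotient in chart [j] is the image of that in chart [i] under
    one continuous linear map, so the limit passes through. *)
Lemma vertical_derive_tangent (X Y : pifield A) u :
  pi_vector_field X -> pi_vector_field Y -> tangent (base u) (vertical_derive X Y u).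
Proof.
move=> pX pY; split=> [i j di dj|i ndi]; last first.
  by rewrite /vertical_derive; case: pselect.
rewrite !vertical_deriveE //.
have dL := atlas_diff HA di dj.
have dY : derivable (slocal i (fun v => Y v i)) (scoord i u) (0, X u i).
  apply: diff_derivable; apply: (smooth_in_differentiable (p := u)) => //.
  by have [_ sY] := pY; exact: sY.
apply: cvg_lim => //.
have -> : (fun h : R => h^-1 *: ((slocal j (fun v => Y v j) \o shift (scoord j u))
      (h *: ((0, X u j) : V * V)) - slocal j (fun v => Y v j) (scoord j u))) =
   'd (local_expr i (coord j)) (coord i (base u)) \o
   (fun h : R => h^-1 *: ((slocal i (fun v => Y v i) \o shift (scoord i u))
      (h *: ((0, X u i) : V * V)) - slocal i (fun v => Y v i) (scoord i u))).
  apply/funext => h /=.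
  have [tX _] := pX.
  have e0 := slocal_fibre 0 pY (tX u) di dj.
  rewrite !scale0r !add0r in e0.
  rewrite (slocal_fibre h pY (tX u) di dj) e0 [RHS]linearZ.
  by congr (_ *: _); rewrite linearB.
apply: (cvg_comp _ _ dY); exact: diff_continuous.
Qed.

Lemma vertical_derive_smooth (X Y : pifield A) (i : idx SA) :
  pi_vector_field X -> pi_vector_field Y ->
  smooth_in i (fun u => vertical_derive X Y u i).
Proof.
move=> [_ sX] [_ sY] k; have iO := open_chart_image HS i.
(* The direction [X] varies with the point, so it is expanded in the basis. Each term costs one
   derivative of [Y], hence the order [k.+1] below. *)
pose F j x := slocal i (fun v => X v i) x 0 j *:
  'D_((0, delta_mx 0 j) : V * V) (slocal i (fun v => Y v i)) x.
apply: (Ck_ext iO (f := fun x => \sum_j F j x)).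
  move=> _ [u du <-]; rewrite (local_exprK HS) // vertical_deriveE //.
  have dY := smooth_in_differentiable (sY i) du.
  rewrite deriveE //.
  have -> : (0, X u i) = \sum_j X u i 0 j *: ((0, delta_mx 0 j) : V * V).
    rewrite [LHS]surjective_pairing [RHS]surjective_pairing /=.
    rewrite (big_morph fst (id1 := 0) (op1 := +%R)) //.
    rewrite (big_morph snd (id1 := 0) (op1 := +%R)) //.
    rewrite -row_sum_delta big1 // => j _; exact: scaler0.
  rewrite linear_sum; apply: eq_bigr => j _.
  by rewrite linearZ /F (local_exprK HS) // deriveE.
apply: (Ck_sum iO) => j; apply: (CkZ iO); first exact: (Ck_coord iO _ (sX i k)).
by have [_ /(_ (0, delta_mx 0 j))] := sY i k.+1.
Qed.

Lemma vertical_derive_pi (X Y : pifield A) :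
  pi_vector_field X -> pi_vector_field Y -> pi_vector_field (vertical_derive X Y).
Proof.
move=> pX pY; split=> [u|i]; first exact: vertical_derive_tangent.
exact: vertical_derive_smooth.
Qed.

End PiVectorFields.

(** * Regular connections *)

Lemma unitmx_of_inj (F : fieldType) n (B : 'M[F]_n) :
  (forall v : 'rV_n, v *m B = 0 -> v = 0) -> B \in unitmx.
Proof.
move=> inj; rewrite unitmxE unitfE; apply/det0P => -[v v0 vB].
by move/eqP: v0; apply; exact: inj.
Qed.

Section Connections.
Variables (R : realType) (n : nat) (M : topologicalType) (A : atlas M 'rV[R]_n).
Hypothesis hM : smooth_manifold A.
Local Notation V := 'rV[R]_n.
Local Notation SA := (slit_atlas A).
Local Notation scoord i := (@coord _ _ SA i).
Local Notation slocal i F := (local_expr (A := SA) i F).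
Let HA := manifold_atlas hM.
Let HS := slit_atlas_differentiable hM.

Variable D : connection A.
Hypothesis lD : linear_connection D.

Lemma connection_vector0 u Y : pi_vector_field Y -> D u 0 Y = 0.
Proof.
move=> pY; have t0 := tangent0 SA u.
have := connection_linear lD 1 t0 t0 pY.
by rewrite !scale1r addr0 => /eqP; rewrite -subr_eq0 opprD addNKr oppr_eq0 => /eqP.
Qed.

Lemma connection_field0 u w : tangent (A := SA) u w -> D u w 0 = 0.
Proof.
move=> tw; have p0 := pi_vector_field0 hM.
have := connection_additive lD tw p0 p0.
by rewrite addr0 => /eqP; rewrite -subr_eq0 opprD addNKr oppr_eq0 => /eqP.
Qed.

Lemma cov_gamma_pi (X Y : pifield A) : pi_vector_field X -> pi_vector_field Y ->
  pi_vector_field (cov D (gammaF X) Y).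
Proof.
move=> pX pY; split=> [u|i].
  exact: (connection_tangent lD (gammaF_tangent hM u pX) pY).
apply: (connection_smooth lD) => // [u _|]; first exact: gammaF_tangent.
exact: gammaF_smooth.
Qed.

Hypothesis rD : regular D.

(** The difference is both vertical and horizontal, hence 0 by regularity. *)
Lemma horizontal_rho_inj u w1 w2 : horizontal D u w1 -> horizontal D u w2 ->
  rho w1 = rho w2 -> w1 = w2.
Proof.
move=> [t1 h1] [t2 h2] e; apply/subr0_eq; have t12 := tangentB t1 t2.
have [_] := rD u; apply; split=> //.
  by apply/funext => i; move/(congr1 (@^~ i)): e; rewrite /rho /= => ->; rewrite subrr.
have -> : w1 - w2 = -1 *: w2 + w1 by rewrite scaleN1r addrC.
rewrite (connection_linear lD) //; last exact: (eta_pi_vector_field hM).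
by rewrite h1 h2 scaler0 addr0.
Qed.

Lemma betaP u v : tangent (base u) v ->
  horizontal D u (beta D u v) /\ rho (beta D u v) = v.
Proof.
move=> tv; rewrite /beta; apply: (@xgetPex _ 0 [set w | horizontal D u w /\ rho w = v]).
have [i di] := charts_cover hM (base u).
(* Some tangent vector over [v]; the fibre part 0 is arbitrary. Its horizontal part [w2] still lies
   over [v], because [rho] kills the vertical part. *)
pose w := tangent_ext (A := SA) i u (v i, 0).
have tw : tangent (A := SA) u w by exact: (tangent_ext_tangent HS).
have [/(_ w tw) [w1 [w2 [[t1 r1] h2 we]]] _] := rD u.
exists w2; split=> //; have [t2 _] := h2.
apply: (tangent_inj di (rho_tangent hM t2) tv).
have -> : v i = rho w i.
  by rewrite /rho /w (tangent_ext_coord HS).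
by rewrite we /rho /=; move/(congr1 (@^~ i)): r1; rewrite /rho /= => ->; rewrite add0r.
Qed.

Lemma beta0 u : beta D u 0 = 0.
Proof.
have [h r] := betaP (tangent0 A (base u)).
apply: (horizontal_rho_inj h); last by rewrite r.
by split; [exact: tangent0 | rewrite connection_vector0 //; exact: (eta_pi_vector_field hM)].
Qed.

(** * The horizontal lift in a chart *)

Section LocalHorizontalLift.
Variable i : idx SA.

(** The map [K] read in chart [i], on the local field with constant components [e]. *)
Definition Kcoord (e : V * V) (u : slit A) : V :=
  D u (tangent_ext (A := SA) i u e) (@eta R n M A) i.

Lemma Kcoord_smooth e : smooth_in i (Kcoord e).
Proof.
apply: (connection_smooth lD (X := fun u => tangent_ext (A := SA) i u e)).
- by move=> u du; exact: (tangent_ext_tangent HS).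
- apply: (smooth_in_ext (F := fun=> e)); last exact: (smooth_in_cst HS).
  by move=> u du; rewrite (tangent_ext_coord HS).
- exact: (eta_pi_vector_field hM).
Qed.

Lemma Kcoord_linear u : dom i u -> linear (Kcoord ^~ u).
Proof.
move=> du a e f; rewrite /Kcoord tangent_ext_linear.
rewrite (connection_linear lD) //; try exact: (tangent_ext_tangent HS).
exact: (eta_pi_vector_field hM).
Qed.

(* The matrix in chart i of K restricted to the range of j; with j the two
   injections it gives the horizontal and vertical blocks of K. *)
Definition Kmx (j : V -> V * V) (x : V * V) : 'M[R]_n :=
  \matrix_k slocal i (Kcoord (j (delta_mx 0 k))) x.

Lemma Kmx_differentiable j u : dom i u -> mx_differentiable (scoord i u) (Kmx j).
Proof.
move=> du k l.
have -> : (fun y => Kmx j y k l : R^o) =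
    fun y => slocal i (Kcoord (j (delta_mx 0 k))) y 0 l.
  by apply/funext => y; rewrite mxE.
apply: mx_differentiable_row.
exact: (smooth_in_differentiable (Kcoord_smooth _) du).
Qed.

Lemma mul_Kmx (j : V -> V * V) u b : linear j -> dom i u ->
  b *m Kmx j (scoord i u) = Kcoord (j b) u.
Proof.
move=> lj du; rewrite mulmx_sum_row [in RHS](row_sum_delta b).
pose l := Kcoord ^~ u \o j.
have ll : linear l by move=> a x y; rewrite /l /= lj Kcoord_linear.
pose mll := GRing.isLinear.Build _ _ _ _ l ll.
pose L : {linear V -> V} := HB.pack l mll.
rewrite -[RHS]/(L _) linear_sum; apply: eq_bigr => k _.
by rewrite linearZ rowK (local_exprK HS).
Qed.

Let inl (a : V) : V * V := (a, 0).
Let inr (b : V) : V * V := (0, b).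

(** A row in the kernel yields a vertical vector that is also horizontal, hence 0 by regularity. *)
Lemma Kmx_unit u : dom i u -> Kmx inr (scoord i u) \in unitmx.
Proof.
move=> du; apply: unitmx_of_inj => b.
have lr : linear inr by move=> a x y; congr pair; rewrite /= ?scaler0 ?addr0.
rewrite mul_Kmx // /Kcoord => K0; pose w := tangent_ext (A := SA) i u (inr b).
have tw : tangent (A := SA) u w by exact: (tangent_ext_tangent HS).
have wi : w i = inr b by rewrite /w (tangent_ext_coord HS).
have peta := eta_pi_vector_field hM.
suff w0 : w = 0 by move: wi; rewrite w0 => -[].
have [_] := rD u; apply; split=> //.
  apply: (@tangent_inj _ _ _ A i (base u) (rho w) 0 du).
  - exact: (rho_tangent hM).
  - exact: tangent0.
  - by rewrite /rho wi.
apply: (@tangent_inj _ _ _ A i (base u) _ 0 du).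
- exact: (connection_tangent lD).
- exact: tangent0.
- exact: K0.
Qed.

(** In the chart the lift is [(v i, b)], and horizontality is a linear equation in [b] whose matrix
    is invertible by [Kmx_unit]. *)
Lemma beta_coord u v : dom i u -> tangent (base u) v ->
  beta D u v i =
  (v i, - (v i *m Kmx inl (scoord i u) *m invmx (Kmx inr (scoord i u)))).
Proof.
move=> du tv; have [[tb hb] rb] := betaP tv.
have b1 : (beta D u v i).1 = v i by rewrite -[in RHS]rb.
set b := (beta D u v i).2.
have bE : beta D u v i = (v i, b) by rewrite -b1 /b -surjective_pairing.
have lr : linear inr by move=> a x y; congr pair; rewrite /= ?scaler0 ?addr0.
have ll : linear inl by move=> a x y; congr pair; rewrite /= ?scaler0 ?addr0.
have e0 : Kcoord (beta D u v i) u = 0.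
  by rewrite /Kcoord -(tangent_extE HS du tb) hb.
have /eqP : v i *m Kmx inl (scoord i u) + b *m Kmx inr (scoord i u) = 0.
  rewrite !mul_Kmx // -e0 bE.
  have := Kcoord_linear du 1 (inl (v i)) (inr b); rewrite !scale1r => <-.
  by congr (Kcoord _ _); congr pair; rewrite /= ?addr0 ?add0r.
rewrite addr_eq0 => /eqP ->.
by rewrite mulNmx opprK mulmxK ?Kmx_unit // bE.
Qed.

(** [beta] is a pointwise choice, so its regularity is read off from the formula of [beta_coord]. It
    is what lets [rho] be moved inside the derivatives of a bracket. *)
Lemma betaF_differentiable (Y : pifield A) u : dom i u -> pi_vector_field Y ->
  differentiable (slocal i (fun v => betaF D Y v i)) (scoord i u).
Proof.
move=> du [tY sY].
pose y := slocal i (fun v => Y v i).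
apply: (differentiable_near_eq (f := fun x =>
  (y x, - (y x *m Kmx inl x *m invmx (Kmx inr x))))).
  apply: (near_chart HS du du) => v dv _.
  by rewrite /y !(local_exprK HS) // /betaF (beta_coord dv (tY v)).
have dy : differentiable y (scoord i u) by exact: smooth_in_differentiable.
apply: differentiable_pair => //; apply: differentiableN.
apply: differentiable_row => j; apply: mx_differentiable_mul.
  apply: mx_differentiable_mul; first exact: mx_differentiable_row.
  exact: Kmx_differentiable.
apply: mx_differentiable_inv; last exact: Kmx_differentiable.
by apply: (near_chart HS du du) => v dv _; exact: Kmx_unit.
Qed.

End LocalHorizontalLift.

Lemma torsionT_vertical (X Y : pifield A) : pi_vector_field X -> pi_vector_field Y ->
  torsionT D X Y = cov D (gammaF X) Y - vertical_derive X Y.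
Proof.
move=> pX pY; have [tY sY] := pY; have [tX sX] := pX.
have rbE : rhoF (betaF D Y) = Y.
  by apply/funext => u; have [_ e] := betaP (tY u); exact: e.
have rg0 : rhoF (gammaF X) = 0 by apply/funext.
rewrite /torsionT /torsion rbE rg0.
have -> : cov D (betaF D Y) 0 = 0.
  apply/funext => u; have [[tb _] _] := betaP (tY u).
  exact: connection_field0.
rewrite subr0; congr (_ - _); apply/funext => u; apply/funext => i.
have [du|ndu] := pselect (dom i (base u)); last first.
  rewrite /rhoF /rho /bracket /vertical_derive.
  by case: pselect => //; case: pselect.
rewrite vertical_deriveE // /rhoF /rho /bracket; case: pselect => // ?.
have dg : differentiable (slocal i (fun v => gammaF X v i)) (scoord i u).
  exact: (smooth_in_differentiable (gammaF_smooth hM i pX) du).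
have db := betaF_differentiable du pY.
(* At a point of differentiability the derivative commutes with [fst]. After this exchange the
   bracket shows only the projections [Y] and 0. *)
have fst_derive (F : slit A -> V * V) v : differentiable (slocal i F) (scoord i u) ->
   ('D_v (slocal i F) (scoord i u)).1 = 'D_v (slocal i (fst \o F)) (scoord i u).
  move=> dF; have [df ef] := is_diff_fst (slocal i F (scoord i u)).
  rewrite local_expr_comp // deriveE // deriveE; last exact: differentiable_comp.
  by rewrite (diff_comp dF df) ef.
transitivity (('D_(gammaF X u i) (slocal i (fun v => betaF D Y v i)) (scoord i u)).1
  - ('D_(betaF D Y u i) (slocal i (fun v => gammaF X v i)) (scoord i u)).1) => //.
rewrite -[RHS]subr0; congr (_ - _).
  apply: etrans (fst_derive _ _ db) _.
  have -> // : fst \o (fun v => betaF D Y v i) = fun v => Y v i.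
  by apply/funext => v; rewrite -[in RHS]rbE.
apply: etrans (fst_derive _ _ dg) _.
have -> : slocal i (fst \o (fun v => gammaF X v i)) = cst 0.
  by apply/funext => x; rewrite /local_expr; case: pselect.
exact: derive_cst.
Qed.

End Connections.

(** * Conformal change *)

Section MetricDerivative.
Variables (R : realType) (n : nat) (M : topologicalType) (A : atlas M 'rV[R]_n).
Hypothesis hM : smooth_manifold A.
Local Notation V := 'rV[R]_n.
Local Notation SA := (slit_atlas A).
Local Notation scoord i := (@coord _ _ SA i).
Local Notation slocal i F := (local_expr (A := SA) i F).
Let HS := slit_atlas_differentiable hM.

(* No derivability is needed: 'D is 0 when the limit does not exist. *)
Lemma derive_vertical_scale (F G : slit A -> R^o) (c : R) u (i : idx A) (b : V) :
  dom i (base u) -> c != 0 ->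
  (forall v, base v = base u -> F v = c * G v) ->
  'D_((0, b) : V * V) (slocal i F) (scoord i u) =
    c * 'D_((0, b) : V * V) (slocal i G) (scoord i u).
Proof.
move=> du c0 FG.
have line y : slocal i F (coord i (base u), y) = c * slocal i G (coord i (base u), y).
  have [[v dv vy]|nv] := pselect (chart_image (A := SA) i (coord i (base u), y)).
    rewrite -vy !(local_exprK HS) //; apply: FG.
    exact: (chart_inj hM (mem_set dv) (mem_set du) (congr1 fst vy)).
  by rewrite !local_expr_out // mulr0.
rewrite /derive; set q := (X in _ = c * lim (X @ _)).
have -> : (fun h : R => h^-1 *: ((slocal i F \o shift (scoord i u))
    (h *: ((0, b) : V * V)) - slocal i F (scoord i u))) = c \*: q.
  apply/funext => h; rewrite /q /=.
  have -> : h *: ((0, b) : V * V) + (coord i (base u), vec u i) =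
      (coord i (base u), h *: b + vec u i).
    by congr pair; rewrite /= scaler0 add0r.
  by rewrite !line -mulrBr scalerA [c *: _]scalerA mulrC.
have [cq|ncq] := pselect (cvg (q @ 0^')); first exact: limZl_tmp.
(* As [c] is nonzero, the scaled quotient diverges together with [q], and both limits are the
   default 0. *)
rewrite (dvgP ncq) (_ : point = 0) // mulr0 dvgP // is_cvgZlE //.
Qed.

End MetricDerivative.

(** Here [d] and [d'] stand for the pairings of [nabla Y] with [Z] and of [nabla Z] with [Y], [e]
    and [e'] for those of [nablat], [p] and [p'] for those of the vertical derivatives, and [V] for
    the derivative of the pairing of [Y] and [Z]. Metricity gives d + d' = e + e', symmetry of the
    torsion gives d - d' = p - p' = e - e'. *)
Lemma koszul (F : realFieldType) (c d d' e e' p p' V : F) : c != 0 ->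
  V = d + d' -> c * V = c * e + c * e' ->
  d - p = d' - p' -> c * (e - p) = c * (e' - p') -> d = e.
Proof.
move=> c0 -> /eqP; rewrite -mulrDr => /eqP/(mulfI c0) h1 h2 /(mulfI c0) h3.
lra.
Qed.

Section ConformalChange.
Variables (R : realType) (n : nat) (M : topologicalType) (A : atlas M 'rV[R]_n).
Hypothesis hM : smooth_manifold A.
Variables (L Lt : M -> vfam A -> R) (nabla nablat : connection A).
Hypotheses (hL : finsler L) (hconf : conformal L Lt).
Hypotheses (hnabla : cartan L nabla) (hnablat : cartan Lt nablat).

Lemma metricB u v1 v2 w : tangent (base u) v1 -> tangent (base u) v2 ->
  tangent (base u) w ->
  metric L u (v1 - v2) w = metric L u v1 w - metric L u v2 w.
Proof.
move=> t1 t2 tw; have [lin _ _] := finsler_metric hL u.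
have -> : v1 - v2 = -1 *: v2 + v1 by rewrite scaleN1r addrC.
by rewrite lin // mulN1r addrC.
Qed.

Lemma metricC u v w : tangent (base u) v -> tangent (base u) w ->
  metric L u v w = metric L u w v.
Proof. by have [_ sym _] := finsler_metric hL u; exact: sym. Qed.

Lemma metric_cov_gamma_conformal (X Y Z : pifield A) u :
  pi_vector_field X -> pi_vector_field Y -> pi_vector_field Z ->
  metric L u (cov nabla (gammaF X) Y u) (Z u) =
  metric L u (cov nablat (gammaF X) Y u) (Z u).
Proof.
move=> pX pY pZ; have [sigma [_ _ conf]] := hconf.
have [lD rD mD _ TD] := hnabla; have [lE rE mE _ TE] := hnablat.
have [i du] := charts_cover hM (base u).
have [[tX _] [tY _] [tZ _]] := And3 pX pY pZ.
have tg := gammaF_tangent hM u pX.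
(* The conformal factor is frozen at [base u]: it is constant on the fibre, so a vertical derivative
   does not see its variation. *)
pose c := expR (2 * sigma (base u)).
have confu v w : tangent (base u) v -> tangent (base u) w ->
  metric Lt u v w = c * metric L u v w by exact: conf.
have c0 : c != 0 by rewrite lt0r_neq0 // expR_gt0.
have [tDY _] := cov_gamma_pi hM lD pX pY.
have [tDZ _] := cov_gamma_pi hM lD pX pZ.
have [tEY _] := cov_gamma_pi hM lE pX pY.
have [tEZ _] := cov_gamma_pi hM lE pX pZ.
have tPY := vertical_derive_tangent hM u pX pY.
have tPZ := vertical_derive_tangent hM u pX pZ.
have metD := mD u _ Y Z i tg pY pZ du.
have metE := mE u _ Y Z i tg pY pZ du.
have scal := @derive_vertical_scale _ _ _ _ hM
  (fun u' => metric Lt u' (Y u') (Z u')) (fun u' => metric L u' (Y u') (Z u'))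
  c u i (X u i) du c0.
have symD := TD X Y Z pX pY pZ u.
have symE := TE X Y Z pX pY pZ u.
rewrite (torsionT_vertical hM lD rD pX pY) (torsionT_vertical hM lD rD pX pZ) in symD.
rewrite (torsionT_vertical hM lE rE pX pY) (torsionT_vertical hM lE rE pX pZ) in symE.
have scal0 v : base v = base u -> metric Lt v (Y v) (Z v) = c * metric L v (Y v) (Z v).
  by move=> bv; rewrite /c -bv; exact: conf v _ _ (tY v) (tZ v).
have symDu : metric L u (cov nabla (gammaF X) Y u - vertical_derive X Y u) (Z u) =
  metric L u (cov nabla (gammaF X) Z u - vertical_derive X Z u) (Y u) by exact: symD.
have symEu : metric Lt u (cov nablat (gammaF X) Y u - vertical_derive X Y u) (Z u) =
  metric Lt u (cov nablat (gammaF X) Z u - vertical_derive X Z u) (Y u) by exact: symE.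
(* From here the terms in [Lt] are rewritten through [metric L], in the shape that [koszul]
   expects. *)
have dE : metric Lt u (cov nablat (gammaF X) Y u) (Z u)
     + metric Lt u (Y u) (cov nablat (gammaF X) Z u) =
   c * metric L u (cov nablat (gammaF X) Y u) (Z u)
     + c * metric L u (cov nablat (gammaF X) Z u) (Y u).
  by rewrite (metricC (tEZ u) (tY u)) (confu _ _ (tEY u) (tZ u)) (confu _ _ (tY u) (tEZ u)).
have dD : metric L u (cov nabla (gammaF X) Y u) (Z u)
     + metric L u (Y u) (cov nabla (gammaF X) Z u) =
   metric L u (cov nabla (gammaF X) Y u) (Z u)
     + metric L u (cov nabla (gammaF X) Z u) (Y u).
  exact: congr1 (metricC (tY u) (tDZ u)).
have pD := etrans (esym (metricB (tDY u) tPY (tZ u)))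
  (etrans symDu (metricB (tDZ u) tPZ (tY u))).
have e1 := confu _ _ (tangentB (tEY u) tPY) (tZ u).
have e2 := confu _ _ (tangentB (tEZ u) tPZ) (tY u).
have e3 := congr1 ( *%R c) (metricB (tEY u) tPY (tZ u)).
have e4 := congr1 ( *%R c) (metricB (tEZ u) tPZ (tY u)).
have pE := etrans (esym (etrans e1 e3)) (etrans symEu (etrans e2 e4)).
exact: (koszul c0 (etrans metD dD) (etrans (esym (scal scal0)) (etrans metE dE)) pD pE).
Qed.

Lemma cov_gamma_conformal (X Y : pifield A) :
  pi_vector_field X -> pi_vector_field Y ->
  cov nabla (gammaF X) Y = cov nablat (gammaF X) Y.
Proof.
move=> pX pY; apply/funext => u; apply/subr0_eq.
have pDY := cov_gamma_pi hM (cartan_connection hnabla) pX pY.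
have pEY := cov_gamma_pi hM (cartan_connection hnablat) pX pY.
have [[tDY _] [tEY _]] := conj pDY pEY.
have tB := tangentB (tDY u) (tEY u).
apply: contrapT => neq0; have [_ _ pos] := finsler_metric hL u.
(* The difference at [u] is paired with its own two terms, which come from global [pi]-vector
   fields; this avoids extending a single vector at [u] to a field. *)
have BW W : pi_vector_field W -> metric L u (W u)
    (cov nabla (gammaF X) Y u - cov nablat (gammaF X) Y u) = 0.
  move=> pW; have [tW _] := pW.
  rewrite (metricC (tW u) tB) (metricB (tDY u) (tEY u) (tW u)).
  by rewrite (metric_cov_gamma_conformal u pX pY pW) subrr.
have := pos _ tB neq0; rewrite (metricB (tDY u) (tEY u) tB).
by rewrite (BW _ pDY) (BW _ pEY) subrr ltxx.
Qed.

End ConformalChange.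

(** * Transfer of recurrence between connections that agree along vertical fields *)

Section Transfer.
Variables (R : realType) (n : nat) (M : topologicalType) (A : atlas M 'rV[R]_n).
Hypothesis hM : smooth_manifold A.

Lemma torsionT_pi (D : connection A) (X Y : pifield A) :
  linear_connection D -> regular D -> pi_vector_field X -> pi_vector_field Y ->
  pi_vector_field (torsionT D X Y).
Proof.
move=> lD rD pX pY; rewrite torsionT_vertical //.
apply: pi_vector_fieldB => //; first exact: cov_gamma_pi.
exact: vertical_derive_pi.
Qed.

(** As [rho] kills [gammaF X], the [Phat] term is the curvature with first argument 0, and each of
    its three summands is a derivative along 0 or of the field 0. *)
Lemma berwald_gamma (D : connection A) (X Y : pifield A) :
  linear_connection D -> regular D -> pi_vector_field X -> pi_vector_field Y ->
  berwald D (gammaF X) Y =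
    cov D (gammaF X) Y - torsionT D (cov D (gammaF X) (@eta R n M A)) Y.
Proof.
move=> lD rD pX pY; rewrite /berwald; congr (_ - _).
have -> : rhoF (gammaF X) = 0 by apply/funext.
rewrite -[RHS]addr0; congr (_ + _).
have peta := eta_pi_vector_field hM.
have b0 : betaF D 0 = 0 by apply/funext => u; exact: (beta0 hM lD rD).
have c0 Z : pi_vector_field Z -> cov D 0 Z = 0.
  by move=> pZ; apply/funext => u; exact: (connection_vector0 lD u pZ).
have br0 : bracket (A := slit_atlas A) 0 (gammaF Y) = 0.
  apply/funext => u; apply/funext => i; rewrite /bracket; case: pselect => // ?.
  rewrite derive0 (_ : local_expr i _ = cst 0) ?derive_cst ?subrr //.
  by apply/funext => x; rewrite /local_expr; case: pselect.
rewrite /Phat /curvature b0 br0 !c0 //; last exact: cov_gamma_pi.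
rewrite oppr0 add0r addr0; apply/funext => u.
exact: (connection_field0 hM lD (gammaF_tangent hM u pY)).
Qed.

Variables D E : connection A.
Hypotheses (lD : linear_connection D) (rD : regular D).
Hypotheses (lE : linear_connection E) (rE : regular E).
Hypothesis DE : forall X Y : pifield A, pi_vector_field X -> pi_vector_field Y ->
  cov D (gammaF X) Y = cov E (gammaF X) Y.

Lemma torsionT_transfer (X Y : pifield A) : pi_vector_field X -> pi_vector_field Y ->
  torsionT D X Y = torsionT E X Y.
Proof. by move=> pX pY; rewrite !torsionT_vertical // DE. Qed.

Lemma berwald_transfer (X Y : pifield A) : pi_vector_field X -> pi_vector_field Y ->
  berwald D (gammaF X) Y = berwald E (gammaF X) Y.
Proof.
move=> pX pY; have peta := eta_pi_vector_field hM.
rewrite (berwald_gamma lD rD pX pY) (berwald_gamma lE rE pX pY) (DE pX pY) (DE pX peta).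
rewrite (torsionT_transfer (cov_gamma_pi hM lE pX peta) pY).
reflexivity.
Qed.

(** Both torsions and both derivations are compared on [pi]-vector fields only, so [d] has to
    preserve these for the nested terms. *)
Lemma derive_tensor_transfer (d e : pifield A -> pifield A) (Y Z : pifield A) :
  (forall Y, pi_vector_field Y -> pi_vector_field (d Y)) ->
  (forall Y, pi_vector_field Y -> d Y = e Y) ->
  pi_vector_field Y -> pi_vector_field Z ->
  derive_tensor d (torsionT D) Y Z = derive_tensor e (torsionT E) Y Z.
Proof.
move=> pd de pY pZ; rewrite /derive_tensor.
rewrite -(torsionT_transfer pY pZ) -(de _ (torsionT_pi lD rD pY pZ)).
rewrite -(de Y pY) -(de Z pZ) -(torsionT_transfer (pd Y pY) pZ).
rewrite -(torsionT_transfer pY (pd Z pZ)).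
reflexivity.
Qed.

Lemma Cv_recurrent_transfer : Cv_recurrent D -> Cv_recurrent E.
Proof.
move=> [lam plam rec]; exists lam; first exact: plam.
move=> X Y Z pX pY pZ.
rewrite -(torsionT_transfer pY pZ); apply: etrans (rec X Y Z pX pY pZ).
apply: esym; apply: (derive_tensor_transfer _ _ pY pZ) => W pW.
- exact: cov_gamma_pi.
- exact: DE.
Qed.

Lemma C0_recurrent_transfer : C0_recurrent D -> C0_recurrent E.
Proof.
move=> [lam plam rec]; exists lam; first exact: plam.
move=> X Y Z pX pY pZ.
rewrite -(torsionT_transfer pY pZ); apply: etrans (rec X Y Z pX pY pZ).
apply: esym; apply: (derive_tensor_transfer _ _ pY pZ) => W pW.
- have peta := eta_pi_vector_field hM; rewrite (berwald_gamma lD rD pX pW).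
  apply: (pi_vector_fieldB hM); first exact: cov_gamma_pi.
  exact: (torsionT_pi lD rD (cov_gamma_pi hM lD pX peta) pW).
- exact: berwald_transfer.
Qed.

End Transfer.

Theorem proposition3p21 (R : realType) (n : nat) (M : topologicalType)
    (A : atlas M 'rV[R]_n) (hM : smooth_manifold A)
    (L Lt : M -> vfam A -> R)
    (hL : finsler L) (hLt : finsler Lt) (hconf : conformal L Lt)
    (nabla nablat : connection A)
    (hnabla : cartan L nabla) (hnablat : cartan Lt nablat) :
  (Cv_recurrent nabla <-> Cv_recurrent nablat) /\
  (C0_recurrent nabla <-> C0_recurrent nablat).
Proof.
have [lD rD _ _ _] := hnabla; have [lE rE _ _ _] := hnablat.
have DE := cov_gamma_conformal hM hL hconf hnabla hnablat.
(* The converse implications reverse this equality instead of exchanging [L] and [Lt]: [conformal]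
   asks for a positive [sigma], and [- sigma] is not positive. *)
have ED X Y : pi_vector_field X -> pi_vector_field Y ->
    cov nablat (gammaF X) Y = cov nabla (gammaF X) Y.
  by move=> pX pY; rewrite DE.
split; split.
- exact: (Cv_recurrent_transfer hM lD rD lE rE).
- exact: (Cv_recurrent_transfer hM lE rE lD rD).
- exact: (C0_recurrent_transfer hM lD rD lE rE).
- exact: (C0_recurrent_transfer hM lE rE lD rD).
Qed.
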